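(* Let $\mathcal{H}$ be a Hilbert space and $\mathcal{G}$ a normed space. Let $I=\{1,\dots,m\}$, $I_0=\{m+1,\dots,n\}$ (possibly $I_0=\emptyset$), and let $h_i:\mathcal{G}\times\mathcal{H}\to\mathbb{R}$, $i=1,\dots,n$, be jointly continuous functions whose partial gradients $\nabla_x h_i$ are jointly continuous. Define $F(p)=\{x\in\mathcal{H}\mid h_i(p,x)\le 0,\ i\in I,\ h_i(p,x)=0,\ i\in I_0\}$. Let $(p^0,x^0)\in\mathrm{gr}F$ and assume $F$ is lower semicontinuous at $(p^0,x^0)$ relative to $\mathrm{dom}F$. Then the following are equivalent: (a) $F$ is R-regular at $(p^0,x^0)$ relative to $\mathrm{dom}F$; (b) there exists $M>0$ such that for any sequences $p^k\to p^0$ with $p^k\in\mathrm{dom}F$ and $v^k\to x^0$ with $v^k\notin F(p^k)$, one has $\Lambda^M_{v^k}(p^k,x^k)\neq\emptyset$ for all $x^k\in\Pi_{F(p^k)}(v^k)$ and all $k$ sufficiently large.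
   Context: $\mathrm{dom}F=\{p\mid F(p)\neq\emptyset\}$, $\mathrm{gr}F=\{(p,x)\mid x\in F(p)\}$. $F$ is lower semicontinuous at $(p^0,x^0)$ relative to $P$ if for every neighbourhood $V(x^0)$ there is a neighbourhood $V(p^0)$ with $F(p)\cap V(x^0)\neq\emptyset$ for all $p\in V(p^0)\cap P$. $F$ is R-regular at $(p^0,x^0)$ relative to $P$ if there exist $M>0$ and neighbourhoods $V(p^0)$, $V(x^0)$ with $\mathrm{dist}(x,F(p))\le M\max\{0,\ h_i(p,x)\ (i\in I),\ |h_i(p,x)|\ (i\in I_0)\}$ for all $x\in V(x^0)$, $p\in V(p^0)\cap P$. For $v\in\mathcal{H}$, $\Pi_{F(p)}(v)=\{\tilde v\in F(p)\mid\|\tilde v-v\|=\mathrm{dist}(v,F(p))\}$. The Lagrange multiplier sets are $\Lambda_v(p,x)=\{\lambda\in\mathbb{R}^n\mid \frac{x-v}{\|x-v\|}+\sum_{i=1}^n\lambda_i\nabla_x h_i(p,x)=0,\ \lambda_i\ge0,\ \lambda_i h_i(p,x)=0 \text{ for } i\in I\}$ and $\Lambda^M_v(p,x)=\{\lambda\in\Lambda_v(p,x)\mid\sum_{i=1}^n|\lambda_i|\le M\}$. *)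

(* Defs.v *)
From HB Require Import structures.
From mathcomp Require Import all_boot all_order all_algebra.
From mathcomp Require Import all_classical all_reals all_analysis.
Set Implicit Arguments. Unset Strict Implicit. Unset Printing Implicit Defensive.
Import Order.TTheory GRing.Theory Num.Theory.
Import numFieldNormedType.Exports.
Local Open Scope classical_set_scope.
Local Open Scope ring_scope.

(* A real Hilbert space is a complete normed space H together with an inner
   product ip : H -> H -> R (symmetric, linear in the first argument) that
   induces its norm: ip x x = |x|^2. *)
Definition inner_product_of (R : realType) (H : normedModType R)
  (ip : H -> H -> R) : Prop :=
  [/\ forall x y, ip x y = ip y x,
      forall (a : R) x y z, ip (a *: x + y) z = a * ip x z + ip y z
    & forall x, ip x x = `|x| ^+ 2].

Definition dist_set (R : realType) (H : normedModType R) (x : H) (S : set H) : R :=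
  inf [set `|x - y| | y in S].

Definition Fset (R : realType) (G H : normedModType R) (n m : nat)
  (h : 'I_n -> G -> H -> R) (p : G) : set H :=
  [set x | forall i : 'I_n, if (i < m)%N then h i p x <= 0 else h i p x == 0].

Definition domF (R : realType) (G H : normedModType R) (n m : nat)
  (h : 'I_n -> G -> H -> R) : set G :=
  [set p | Fset m h p !=set0].

Definition lsc_rel (R : realType) (G H : normedModType R)
  (F : G -> set H) (P : set G) (p0 : G) (x0 : H) : Prop :=
  forall U : set H, nbhs x0 U ->
    exists2 V : set G, nbhs p0 V &
      forall p, V p -> P p -> exists2 x, F p x & U x.

Definition residual (R : realType) (G H : normedModType R) (n m : nat)
  (h : 'I_n -> G -> H -> R) (p : G) (x : H) : R :=
  \big[Num.max/0]_(i < n) (if (i < m)%N then h i p x else `|h i p x|).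

Definition R_regular_rel (R : realType) (G H : normedModType R) (n m : nat)
  (h : 'I_n -> G -> H -> R) (P : set G) (p0 : G) (x0 : H) : Prop :=
  exists2 M : R, 0 < M &
    exists2 Vp : set G, nbhs p0 Vp &
      exists2 Vx : set H, nbhs x0 Vx &
        forall x p, Vx x -> Vp p -> P p ->
          dist_set x (Fset m h p) <= M * residual m h p x.

Definition proj_set (R : realType) (H : normedModType R) (S : set H) (v : H) : set H :=
  [set w | S w /\ `|w - v| = dist_set v S].

(* Lagrange multiplier set Lambda_v(p,x); gh i p x is the partial gradient
   nabla_x h_i(p,x). *)
Definition Lambda (R : realType) (G H : normedModType R) (n m : nat)
  (h : 'I_n -> G -> H -> R) (gh : 'I_n -> G -> H -> H)
  (v : H) (p : G) (x : H) : set ('I_n -> R) :=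
  [set lam | `|x - v|^-1 *: (x - v) + \sum_(i < n) lam i *: gh i p x = 0
             /\ forall i : 'I_n, (i < m)%N -> 0 <= lam i /\ lam i * h i p x = 0].

Definition LambdaM (R : realType) (G H : normedModType R) (n m : nat)
  (h : 'I_n -> G -> H -> R) (gh : 'I_n -> G -> H -> H) (M : R)
  (v : H) (p : G) (x : H) : set ('I_n -> R) :=
  [set lam | Lambda m h gh v p x lam /\ \sum_(i < n) `|lam i| <= M].

(* Main.v *)
(** (a) => (b): let [x] be a projection of [v] onto [F p]. Since
    [dist(., F p)] is 1-Lipschitz, R-regularity makes [x] a local minimizer of
    the exact penalty function [y |-> |y - v| + M * residual p y]. Its
    directional first-order condition, separated over a compact box of
    multipliers, yields an element of [Lambda]; bounding each [|lam i|] by [M]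
    gives the constant [(n + 1) M].

    (b) => (a): if [x] is a projection of [v], pairing the multiplier equation
    with [v - x] and applying the mean value theorem gives
    [|x - v| <= 2 M residual p v] near [(p0, x0)]. In infinite dimension a
    closed set need not have projections, but the points that have one are
    dense (a Baire category argument resting on the uniform convexity of the
    norm), and both sides of the error bound are continuous in [v]. *)
Require Import Defs.
From HB Require Import structures.
From mathcomp Require Import all_boot all_order all_algebra.
From mathcomp Require Import all_classical all_reals all_analysis.
From mathcomp Require Import ring lra.
Import Order.TTheory GRing.Theory Num.Theory.
Import numFieldNormedType.Exports.
Local Open Scope classical_set_scope.
Local Open Scope ring_scope.
Set Implicit Arguments. Unset Strict Implicit. Unset Printing Implicit Defensive.

(** * Distance to a set in a normed space *)

Section DistanceToSet.
Context {R : realType} {H : normedModType R}.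
Implicit Types (S : set H) (v w z : H).

Lemma dist_set_ge0 v S : 0 <= dist_set v S.
Proof.
(* The infimum of the empty set is [0], so the bound also covers empty [S]. *)
have [->|S0] := eqVneq S set0; first by rewrite /dist_set image_set0 inf0.
apply: lb_le_inf; last by move=> _ [z _ <-].
by have /set0P[z Sz] := S0; exists `|v - z|; exists z.
Qed.

Lemma dist_set_le v S z : S z -> dist_set v S <= `|v - z|.
Proof.
by move=> Sz; apply: ge_inf; [exists 0 => _ [y _ <-]|exists z].
Qed.

Lemma le_dist_set v S (c : R) :
  S !=set0 -> (forall z, S z -> c <= `|v - z|) -> c <= dist_set v S.
Proof.
move=> [z Sz] cS; apply: lb_le_inf; first by exists `|v - z|; exists z.
by move=> _ [y Sy <-]; exact: cS.
Qed.

Lemma dist_set_adherent v S (e : R) : S !=set0 -> 0 < e ->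
  exists2 z, S z & `|v - z| < dist_set v S + e.
Proof.
move=> [z Sz] e0; have [|_ [y Sy <-] ye] := inf_adherent (E := [set `|v - y| | y in S]) e0.
  by split; [exists `|v - z|; exists z|exists 0 => _ [y _ <-]].
by exists y.
Qed.

Lemma dist_set_lipschitz v w S : S !=set0 ->
  dist_set v S <= dist_set w S + `|v - w|.
Proof.
move=> S0; rewrite -lerBlDr; apply: le_dist_set => // z Sz.
rewrite lerBlDr; apply: (le_trans (dist_set_le v Sz)).
by rewrite [leRHS]addrC (_ : v - z = (v - w) + (w - z)) ?ler_normD // addrA subrK.
Qed.

End DistanceToSet.

(** * Inner product calculus *)

Section InnerProduct.
Context {R : realType} {H : normedModType R} {ip : H -> H -> R}.
Hypothesis ipP : inner_product_of ip.

Lemma ipC x y : ip x y = ip y x. Proof. by case: ipP. Qed.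

Lemma ipxx x : ip x x = `|x| ^+ 2. Proof. by case: ipP. Qed.

Lemma ip0l z : ip 0 z = 0.
Proof.
case: ipP => _ ipl _; have := ipl 1 0 0 z.
by rewrite scaler0 addr0 mul1r => /eqP; rewrite -subr_eq0 opprD addNKr oppr_eq0 => /eqP.
Qed.

Lemma ipZl a x z : ip (a *: x) z = a * ip x z.
Proof. by case: ipP => _ ipl _; rewrite -[a *: x]addr0 ipl ip0l addr0. Qed.

Lemma ipDl x y z : ip (x + y) z = ip x z + ip y z.
Proof. by case: ipP => _ ipl _; rewrite -{1}[x]scale1r ipl mul1r. Qed.

Lemma ipNl x z : ip (- x) z = - ip x z.
Proof. by rewrite -scaleN1r ipZl mulN1r. Qed.

Lemma ipBl x y z : ip (x - y) z = ip x z - ip y z.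
Proof. by rewrite ipDl ipNl. Qed.

Lemma ipZr a x z : ip z (a *: x) = a * ip z x.
Proof. by rewrite ipC ipZl ipC. Qed.

Lemma ipDr x y z : ip z (x + y) = ip z x + ip z y.
Proof. by rewrite ipC ipDl !(ipC z). Qed.

Lemma ipNr x z : ip z (- x) = - ip z x.
Proof. by rewrite ipC ipNl ipC. Qed.

Lemma ip_suml (I : finType) (F : I -> H) z :
  ip (\sum_i F i) z = \sum_i ip (F i) z.
Proof.
elim/big_rec2: _ => [|i a b _ <-]; [exact: ip0l|exact: ipDl].
Qed.

Lemma sqr_normD x y : `|x + y| ^+ 2 = `|x| ^+ 2 + ip x y *+ 2 + `|y| ^+ 2.
Proof. by rewrite -!ipxx !ipDl !ipDr (ipC y x); ring. Qed.

(** Expand the square of the norm of [|y| x - |x| y], which is nonnegative, and divide by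
    [2 |x| |y|]. *)
Lemma cauchy_schwarz x y : ip x y <= `|x| * `|y|.
Proof.
have [->|x0] := eqVneq x 0; first by rewrite ip0l mulr_ge0.
have [->|y0] := eqVneq y 0; first by rewrite ipC ip0l mulr_ge0.
have xy0 : 0 < `|x| * `|y| by rewrite mulr_gt0 ?normr_gt0.
have := sqr_ge0 `| `|y| *: x - `|x| *: y|.
rewrite sqr_normD ipNr !ipZl !ipZr normrN !normrZ !normr_id => h.
rewrite -(ler_pM2l xy0) -subr_ge0 -(pmulrn_lge0 _ (n := 2)) //.
by apply: le_trans h _; rewrite le_eqVlt; apply/orP; left; apply/eqP; ring.
Qed.

Lemma cauchy_schwarz_norm x y : `|ip x y| <= `|x| * `|y|.
Proof.
by rewrite ler_norml lerNl -ipNl -{1}(normrN x) !cauchy_schwarz.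
Qed.

(* AM-GM applied to |a| |a + u|. *)
Lemma normD_le_inner a u : a != 0 ->
  `|a + u| <= `|a| + ip (`|a|^-1 *: a) u + `|u| ^+ 2 / (`|a| *+ 2).
Proof.
rewrite -normr_gt0 => a0; rewrite ipZl.
have -> : `|a| + `|a|^-1 * ip a u + `|u| ^+ 2 / (`|a| *+ 2) =
   (`|a + u| ^+ 2 + `|a| ^+ 2) / (`|a| *+ 2).
  by rewrite sqr_normD; field; rewrite gt_eqF.
rewrite ler_pdivlMr ?pmulrn_lgt0 //.
by have := sqr_ge0 (`|a + u| - `|a|); rewrite sqrrB; nra.
Qed.

End InnerProduct.

(** * Density of the points that have a nearest point in a closed set *)

Section ProjectionsAreDense.
Context {R : realType} {H : completeNormedModType R} {ip : H -> H -> R}.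
Hypothesis ipP : inner_product_of ip.
Variable S : set H.
Hypothesis S0 : S !=set0.

(** Stewart's identity, solved for the [|z - y|] term. It gives the exact convexity defect of the
    squared distance to [z] along the segment from [v] to [y]. *)
Lemma sqr_norm_convex (t : R) (v y z : H) :
  t * `|z - y| ^+ 2 = `|v + t *: (y - v) - z| ^+ 2 - (1 - t) * `|v - z| ^+ 2
                      + t * (1 - t) * `|v - y| ^+ 2.
Proof.
rewrite (_ : v + t *: (y - v) - z = (v - z) + t *: (y - v)); last by rewrite addrAC.
rewrite (_ : z - y = - ((v - z) + (y - v))); last first.
  by rewrite [v - z + _]addrC subrKA opprB.
rewrite -(opprB y v) !normrN; move: (v - z) (y - v) => a b.
rewrite !(sqr_normD ipP) !(ipZr ipP) normrZ exprMn real_normK ?num_real //; ring.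
Qed.

(* For every e this set is open and dense; at a point lying in all of them,
   minimizing sequences are Cauchy. *)
Definition well_localized (e : R) : set H :=
  [set w | exists y (d : R), 0 < d /\
    forall z, S z -> `|w - z| <= dist_set w S + d -> `|z - y| <= e].

Lemma open_well_localized e : open (well_localized e).
Proof.
rewrite openE => w [y [d [d0 wy]]]; apply/nbhs_ballP; exists (d / 4) => /=.
  by rewrite divr_gt0.
(* Passing from [w'] to [w] costs [d / 4] in the norm and [d / 4] in the distance to [S]; with the
   new slack [d / 4] the total stays below [d]. *)
move=> w'; rewrite -ball_normE /= => ww'.
exists y, (d / 4); split=> [|z Sz w'z]; first by rewrite divr_gt0.
apply: wy => //.
have h1 : `|w - z| <= `|w - w'| + `|w' - z| by rewrite -(subrKA w' w (- z)) ler_normD.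
have := dist_set_lipschitz w' w S0; rewrite (distrC w') => h2.
lra.
Qed.

(* Moving [v] slightly towards a nearly closest point [y] of [S] makes every
   nearly closest point of [S] lie near [y], by strict convexity of the ball. *)
Lemma dense_well_localized e : 0 < e -> dense (well_localized e).
Proof.
move=> e0 O [v Ov]; rewrite openE => /(_ _ Ov) /nbhs_ballP[r /= r0 rO].
set d := dist_set v S.
have d0 : 0 <= d := dist_set_ge0 v S.
(* The first bound keeps [1 - t] positive; the second keeps the moved point in the ball of radius
   [r], since [|v - y| < d + 1]. *)
pose t := Num.min (1 / 2) (r / (2 * (d + 1))).
have t0 : 0 < t by rewrite lt_min !divr_gt0 ?mulr_gt0 ?ltr_wpDl.
have t1 : t <= 1 / 2 by rewrite ge_min lexx.
have td : t * (d + 1) <= r / 2.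
  have : t <= r / (2 * (d + 1)) by rewrite ge_min lexx orbT.
  by rewrite invfM mulrA ler_pdivlMr ?ltr_wpDl.
(* In the final estimate the [d ^+ 2] terms cancel, and for [eta <= 1] the remaining ones add up to
   at most [eta * (6 * d + 5)]. *)
pose eta := Num.min 1 (t * e ^+ 2 / (6 * d + 5)).
have c0 : 0 < 6 * d + 5 by lra.
have eta0 : 0 < eta by rewrite lt_min ltr01 divr_gt0 ?mulr_gt0 ?exprn_gt0.
have eta1 : eta <= 1 by rewrite ge_min lexx.
have etaE : eta * (6 * d + 5) <= t * e ^+ 2.
  have : eta <= t * e ^+ 2 / (6 * d + 5) by rewrite ge_min lexx orbT.
  by rewrite ler_pdivlMr.
have [y Sy vy] := dist_set_adherent v S0 eta0; rewrite -/d in vy.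
have vy0 : d <= `|v - y| := dist_set_le v Sy.
exists (v + t *: (y - v)); split.
  apply: rO; rewrite -ball_normE /= opprD addNKr normrN normrZ gtr0_norm // distrC.
  have h1 : t * `|v - y| <= t * (d + 1) by rewrite ler_wpM2l; lra.
  by lra.
exists y, eta; split=> // z Sz.
set a := `| _ - z| => az.
have vz : d <= `|v - z| := dist_set_le v Sz.
have d1 : dist_set (v + t *: (y - v)) S <= (1 - t) * `|v - y|.
  apply: (le_trans (dist_set_le _ Sy)).
  rewrite (_ : _ - y = (1 - t) *: (v - y)).
    by rewrite normrZ ger0_norm // subr_ge0; lra.
  by rewrite scalerBl scale1r -(opprB v y) scalerN addrAC.
have a0 : 0 <= a by exact: normr_ge0.
have := sqr_norm_convex t v y z; rewrite -/a => E.
have a1 : a <= (1 - t) * d + 2 * eta.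
  have h1 : (1 - t) * `|v - y| <= (1 - t) * (d + eta) by rewrite ler_wpM2l; lra.
  have h2 : 0 <= t * eta by rewrite mulr_ge0 // ltW.
  by lra.
have a2 : a ^+ 2 <= ((1 - t) * d + 2 * eta) ^+ 2 by rewrite lerXn2r ?nnegrE //; lra.
have z2 : d ^+ 2 <= `|v - z| ^+ 2 by rewrite lerXn2r ?nnegrE.
have y2 : `|v - y| ^+ 2 <= (d + eta) ^+ 2 by rewrite lerXn2r ?nnegrE; lra.
have : t * `|z - y| ^+ 2 <= t * e ^+ 2.
  apply: le_trans etaE; rewrite E.
  have h1 : (1 - t) * d ^+ 2 <= (1 - t) * `|v - z| ^+ 2 by rewrite ler_wpM2l; lra.
  have h2 : t * (1 - t) * `|v - y| ^+ 2 <= t * (1 - t) * (d + eta) ^+ 2.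
    by rewrite ler_wpM2l ?mulr_ge0; lra.
  have h3 : eta ^+ 2 <= eta by rewrite expr2 ler_piMl // ltW.
  have h4 : 0 <= t * (eta * d) by rewrite !mulr_ge0 // ltW.
  have h5 : 0 <= t * t * (eta * d) by rewrite !mulr_ge0 // ltW.
  have h6 : 0 <= eta * d by rewrite mulr_ge0 // ltW.
  have h7 : t * (1 - t) * eta ^+ 2 <= eta.
    apply: le_trans h3; rewrite ler_piMl ?sqr_ge0 // mulr_ile1 ?subr_ge0 //; lra.
  lra.
rewrite ler_pM2l // => ze.
by rewrite -(ler_pXn2r (n := 2)) ?nnegrE // ltW.
Qed.

Hypothesis Scl : closed S.

(** Choose points of [S] within [1 / (k + 1)] of the minimal distance. Localization makes them
    Cauchy, and their limit is in [S] by closedness and attains the distance. *)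
Lemma proj_set_well_localized w :
  (forall k : nat, well_localized (k.+1%:R^-1) w) -> proj_set S w !=set0.
Proof.
move=> wk.
have inv0 (k : nat) : 0 < k.+1%:R^-1 :> R by rewrite invr_gt0.
have inv_small (e : R) : 0 < e -> \forall k \near \oo, k.+1%:R^-1 < e.
  by move=> e0; exact: near_infty_natSinv_lt (PosNum e0).
have /choice[z zP] : forall k : nat, exists z, S z /\ `|w - z| < dist_set w S + k.+1%:R^-1.
  by move=> k; have [z Sz wz] := dist_set_adherent w S0 (inv0 k); exists z.
have zc : cvg (z @ \oo).
  apply/cauchy_cvgP/cauchy_exP => e e0.
  have [K _ /(_ K (leqnn K)) /= Ke] := inv_small e e0.
  have [y [d [d0 yP]]] := wk K.
  exists y; near=> k; rewrite -ball_normE /= distrC; apply: le_lt_trans Ke.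
  have [Sz wz] := zP k; apply: yP => //; apply/ltW/(lt_trans wz).
  by rewrite ltrD2l; near: k; exact: inv_small.
set l := lim (z @ \oo) in zc *.
have zl : z @ \oo --> l by exact: zc.
have Sl : S l by apply: (closed_cvg S Scl _ _ zl); apply: nearW => k; case: (zP k).
exists l; split=> //.
apply/eqP; rewrite distrC eq_le; apply/andP; split; last exact: dist_set_le.
apply/ler_addgt0Pl => e e0.
have e20 : 0 < e / 2 by rewrite divr_gt0.
have [k [kl ke]] : exists k, `|l - z k| <= e / 2 /\ k.+1%:R^-1 < e / 2.
  have /cvgrPdist_le/(_ _ e20) zle := zl.
  have [K _ KP] : \forall k \near \oo, `|l - z k| <= e / 2 /\ k.+1%:R^-1 < e / 2.
    near=> k; split; first by near: k.
    by near: k; exact: inv_small.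
  by exists K; exact: KP (leqnn K).
have [_ wz] := zP k; have wl : `|w - l| <= `|w - z k| + `|l - z k|.
  by rewrite (distrC l) -(subrKA (z k) w (- l)) ler_normD.
move: (k.+1%:R^-1) ke wz => q ke wz; lra.
Unshelve. all: by end_near. Qed.

(** By Baire's theorem the sets [well_localized k.+1%:R^-1], each open and dense, have a dense
    intersection. *)
Lemma dense_proj_set : dense [set w | proj_set S w !=set0].
Proof.
move=> O O0 oO; have [k|w [Ow wP]] := Baire
  (F := fun k : nat => well_localized k.+1%:R^-1) _ O0 oO.
  by split; [exact: open_well_localized|apply: dense_well_localized; rewrite invr_gt0].
by exists w; split=> //; apply: proj_set_well_localized => k; exact: wP.
Qed.

End ProjectionsAreDense.

(** * Existence of multipliers in a compact box *)

Section Multipliers.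
Context {R : realType} {H : normedModType R} {ip : H -> H -> R}.
Hypothesis ipP : inner_product_of ip.

Lemma linear_coef_ge0 (A B : R) :
  (forall s, 0 < s <= 1 -> 0 <= s * A + s ^+ 2 * B) -> 0 <= A.
Proof.
move=> AB; rewrite leNgt; apply/negP => A0.
have B1 : 0 < `|B| + 1 by rewrite ltr_wpDl.
(* If [A < 0], this step size gives [s * B <= - A / 2], so [A + s * B] is still negative. *)
pose s := Num.min 1 (- A / (2 * (`|B| + 1))).
have s0 : 0 < s by rewrite lt_min ltr01 divr_gt0 ?oppr_gt0 ?mulr_gt0.
have s1 : s <= 1 by rewrite ge_min lexx.
have sA : s * (2 * (`|B| + 1)) <= - A.
  by rewrite -ler_pdivlMr ?mulr_gt0 // ge_min lexx orbT.
have := AB s; rewrite s0 s1 => /(_ isT).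
rewrite expr2 -mulrA -mulrDr (pmulr_rge0 _ s0).
have : s * B <= s * `|B| by rewrite ler_wpM2l ?ler_norm // ltW.
move: (s * B) => sB; nra.
Qed.

Lemma row_comb_continuous n (e : H) (g : 'I_n -> H) :
  continuous (fun v : 'rV[R]_n => e + \sum_i v ord0 i *: g i).
Proof.
have sumc : continuous (fun v : 'rV[R]_n => \sum_i v ord0 i *: g i).
  apply: (continuous_big (@add_continuous H)) => i _ v.
  exact: (cvgZr_tmp (@coord_continuous R 1 n ord0 i v)).
by move=> v; exact: (cvgD (cvg_cst e) (sumc v)).
Qed.

(* At a point [w] of minimal norm in the compact set [e + \sum_i [lo i, hi i] g i],
   the hypothesis in direction [- w] reads [`|w| ^+ 2 <= 0]. *)
Lemma box_multipliers n (e : H) (g : 'I_n -> H) (lo hi : 'I_n -> R) :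
  (forall i, lo i <= 0 <= hi i) ->
  (forall u s, 0 <= s -> (forall i, lo i * ip (g i) u <= s) ->
    (forall i, hi i * ip (g i) u <= s) -> 0 <= ip e u + s) ->
  exists lam : 'I_n -> R, e + \sum_i lam i *: g i = 0 /\
    forall i, lo i <= lam i <= hi i.
Proof.
move=> lohi dir.
pose K := [set v : 'rV[R]_n | forall i, `[lo i, hi i]%classic (v ord0 i)].
pose f (v : 'rV[R]_n) := e + \sum_i v ord0 i *: g i.
have [| |c cK cmin] := EVT_min_rV (f := fun v => `|f v|) (A := K) _
  (rV_compact (fun i => @segment_compact R _ _)).
- by exists 0 => i /=; rewrite in_itv /= mxE.
- apply: continuous_subspaceT => v; exact: (cvg_norm (@row_comb_continuous n e g v)).
have {}cK i : lo i <= c ord0 i <= hi i by move: cK; rewrite inE => /(_ i); rewrite /= in_itv.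
have [w wE] : exists w, w = f c by exists (f c).
rewrite -wE in cmin.
have varE i t : f (c + t *: delta_mx ord0 i) = w + t *: g i.
  rewrite wE /f -addrA; congr (_ + _).
  under eq_bigr do rewrite !mxE eqxx /= scalerDl.
  rewrite big_split /=; congr (_ + _).
  rewrite (bigD1 i) //= eqxx mulr1 big1 ?addr0 // => j /negbTE ->.
  by rewrite mulr0 scale0r.
(* Variational inequality at the minimizer: moving only coordinate [i] towards [a] stays in the box,
   so the squared norm has a nonnegative slope. *)
have var i a : lo i <= a <= hi i -> 0 <= (a - c ord0 i) * ip w (g i).
  move=> ai; set dl := a - _.
  suff : 0 <= 2 * (dl * ip w (g i)) by rewrite pmulr_rge0.
  apply: (linear_coef_ge0 (B := dl ^+ 2 * `|g i| ^+ 2)) => s /andP[s0 s1].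
  have /cmin : (c + (s * dl) *: delta_mx ord0 i) \in K.
    rewrite inE => j /=; rewrite in_itv /= !mxE eqxx /=.
    have [->|_] := eqVneq j i; last by rewrite mulr0 addr0.
    rewrite mulr1 /dl; have := cK i; move: ai => /andP[? ?] /andP[? ?].
    by apply/andP; split; nra.
  rewrite varE => le_w.
  have : `|w| ^+ 2 <= `|w + (s * dl) *: g i| ^+ 2 by rewrite lerXn2r ?nnegrE.
  rewrite (sqr_normD ipP) (ipZr ipP) normrZ exprMn real_normK ?num_real //.
  lra.
exists (fun i => c ord0 i); split=> //; apply/eqP; rewrite -normr_eq0 -sqrf_eq0.
rewrite eq_le sqr_ge0 andbT -/(f c) -wE.
(* By [var], [c ord0 i] maximizes [a * ip (g i) (- w)] over an interval containing [0]. The summands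
   are thus nonnegative and [s] is admissible in [dir], while [ip e (- w) + s] equals
   [ip w (- w)]. *)
pose s := \sum_i c ord0 i * ip (g i) (- w).
have term i a : lo i <= a <= hi i -> a * ip (g i) (- w) <= c ord0 i * ip (g i) (- w).
  by move=> /var; rewrite (ipC ipP) (ipNr ipP) mulrBl; lra.
have term0 i : 0 <= c ord0 i * ip (g i) (- w) by have := term i 0 (lohi i); rewrite mul0r.
have les i : c ord0 i * ip (g i) (- w) <= s.
  by rewrite /s (bigD1 i) //= lerDl sumr_ge0.
have : 0 <= ip e (- w) + s.
  apply: dir => [|i|i]; first by rewrite sumr_ge0.
    by apply: le_trans (les i); apply: term; have := lohi i; lra.
  by apply: le_trans (les i); apply: term; have := lohi i; lra.
rewrite /s; under eq_bigr do rewrite -(ipZl ipP).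
by rewrite -(ip_suml ipP) -(ipDl ipP) -/(f c) -wE (ipNr ipP) (ipxx ipP) oppr_ge0.
Qed.

End Multipliers.

(** * First-order condition for the exact penalty function *)

Section PenaltyFirstOrder.
Context {R : realType} {G H : normedModType R} {ip : H -> H -> R}.
Hypothesis ipP : inner_product_of ip.

Lemma difference_quotient_cvg (f : H -> R) (g x u : H) :
  differentiable f x -> 'd f x u = ip g u ->
  t^-1 * (f (x + t *: u) - f x) @[t --> 0^'] --> ip g u.
Proof.
move=> df dfu; have := diff_derivable (v := u) df.
rewrite /derivable -/('D_u f x) deriveE // dfu.
by under eq_fun do rewrite /= [_ *: u + x]addrC.
Qed.

Lemma near_right_difference (f : H -> R) (g x u : H) (e : R) :
  differentiable f x -> 'd f x u = ip g u -> 0 < e ->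
  \forall t \near 0^'+, `|f (x + t *: u) - f x - t * ip g u| <= t * e.
Proof.
move=> df dfu e0.
have /cvg_dnbhs_at_right/cvgrPdist_le/(_ _ e0) := difference_quotient_cvg df dfu.
apply: filter_app; near=> t.
have t0 : 0 < t by near: t; exact: nbhs_right_gt.
move=> hq; have -> : f (x + t *: u) - f x = t * (t^-1 * (f (x + t *: u) - f x)).
  by rewrite mulVKf ?gt_eqF.
by rewrite -mulrBr normrM gtr0_norm // ler_pM2l // distrC.
Unshelve. all: by end_near. Qed.

Context {n : nat} (m : nat) (h : 'I_n -> G -> H -> R) (g : 'I_n -> H).
Variables (p : G) (x v : H) (M r : R).
Hypotheses (M0 : 0 < M) (r0 : 0 < r) (xv : x != v) (Fx : Fset m h p x).
Hypothesis gP : forall i, differentiable (h i p) x /\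
  forall u, 'd (h i p) x u = ip (g i) u.
Hypothesis penalty_min : forall y, `|y - x| < r ->
  `|x - v| <= `|y - v| + M * residual m h p y.

(** The box encodes signs and complementarity: [[0, M]] for an active inequality, [{0}] for an
    inactive one, [[- M, M]] for an equality. *)
Let lo (i : 'I_n) : R := if (i < m)%N then 0 else - M.
Let hi (i : 'I_n) : R := if (i < m)%N && (h i p x < 0) then 0 else M.

(** The larger of [lo i * ip (g i) u] and [hi i * ip (g i) u] is the one-sided derivative along [u]
    of [M] times the positive part, or absolute value, of constraint [i]. As [s] dominates all of
    them, it bounds the slope of the penalty up to [e]. *)
Lemma near_right_residual u s e : 0 < e -> 0 <= s ->
  (forall i, lo i * ip (g i) u <= s) -> (forall i, hi i * ip (g i) u <= s) ->
  \forall t \near 0^'+, M * residual m h p (x + t *: u) <= t * (s + e).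
Proof.
move=> e0 s0 los his; have eM : 0 < e / M by rewrite divr_gt0.
suff : \forall t \near 0^'+, forall i : 'I_n,
    (if (i < m)%N then h i p (x + t *: u) else `|h i p (x + t *: u)|)
      <= t * (s + e) / M.
  apply: filter_app; near=> t => ht.
  have t0 : 0 < t by near: t; exact: nbhs_right_gt.
  rewrite mulrC -ler_pdivlMr //; apply: bigmax_le => //.
  by rewrite divr_ge0 ?mulr_ge0 ?addr_ge0 // ltW.
apply: filter_forall => i.
have [dh /(_ u) dhu] := gP i.
have := near_right_difference dh dhu eM; apply: filter_app.
have := Fx i; have := los i; have := his i; rewrite /lo /hi.
case: (boolP (i < m)%N) => im /=; last first.
  (* Equality constraint: the bounds for [- M] and [M] combine into [|ip (g i) u| <= s / M]. *)
  rewrite mulNr => h1 h2 /eqP h0; near=> t; rewrite h0 subr0 => ht.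
  have t0 : 0 < t by near: t; exact: nbhs_right_gt.
  have /ler_normlP[h3 h4] : `|ip (g i) u| <= s / M.
    by rewrite ler_norml -mulNr ler_pdivrMr // ler_pdivlMr //; apply/andP; split; lra.
  have -> : t * (s + e) / M = t * (s / M) + t * (e / M) by ring.
  move: ht; rewrite !ler_norml => /andP[h5 h6].
  have h7 : t * ip (g i) u <= t * (s / M) by rewrite ler_pM2l.
  have h8 : t * - ip (g i) u <= t * (s / M) by rewrite ler_pM2l.
  by apply/andP; split; lra.
(* An inactive inequality stays nonpositive for small [t]; an active one starts from the value [0],
   and the upper bound from [hi] suffices. *)
case: ifPn => [h0 _ _ _|h0 h1 _ h2].
  have c0 : 0 < `|ip (g i) u| + e / M by rewrite ltr_wpDl.
  near=> t => /ler_normlP[_ ht].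
  have t0 : 0 < t by near: t; exact: nbhs_right_gt.
  have tc : t * (`|ip (g i) u| + e / M) <= - h i p x.
    rewrite -ler_pdivlMr // ltW //; near: t; apply: nbhs_right_lt.
    by rewrite divr_gt0 ?oppr_gt0.
  have h3 : t * ip (g i) u <= t * `|ip (g i) u| by rewrite ler_pM2l ?ler_norm.
  have h4 : 0 <= t * (s + e) / M by rewrite divr_ge0 ?mulr_ge0 ?addr_ge0 // ltW.
  by lra.
have {h0 h2} -> : h i p x = 0 by apply/eqP; rewrite eq_le h2 leNgt.
near=> t; rewrite subr0 => /ler_normlP[_ ht].
have t0 : 0 < t by near: t; exact: nbhs_right_gt.
have -> : t * (s + e) / M = t * (s / M) + t * (e / M) by ring.
have h3 : t * ip (g i) u <= t * (s / M) by rewrite ler_pM2l // ler_pdivlMr // mulrC.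
by lra.
Unshelve. all: by end_near. Qed.

Lemma penalty_first_order u s : 0 <= s ->
  (forall i, lo i * ip (g i) u <= s) -> (forall i, hi i * ip (g i) u <= s) ->
  0 <= ip (`|x - v|^-1 *: (x - v)) u + s.
Proof.
move=> s0 los his; apply/ler_addgt0Pl => e e0.
have e2 : 0 < e / 2 by rewrite divr_gt0.
have xv0 : x - v != 0 by rewrite subr_eq0.
set E := ip _ u.
suff [t [t0 ht]] : exists t, 0 < t /\ 0 <= t * (E + s + e).
  by move: ht; rewrite (pmulr_rge0 _ t0); lra.
(* The point [x + t *: u] must stay where the penalty is minimal at [x]. The slack [e] is split
   between the quadratic term of [normD_le_inner] and the residual. The added [1]s keep the divisors
   positive. *)
have [t] : exists t, [/\ 0 < t, t * (`|u| + 1) < r,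
    t * (`|u| ^+ 2 / (`|x - v| *+ 2) + 1) < e / 2 &
    M * residual m h p (x + t *: u) <= t * (s + e / 2)].
  have u1 : 0 < `|u| + 1 by rewrite ltr_wpDl.
  have u2 : 0 < `|u| ^+ 2 / (`|x - v| *+ 2) + 1.
    by rewrite ltr_wpDl // divr_ge0 ?mulrn_wge0 ?exprn_ge0.
  apply: (@filter_ex _ (0 : R)^'+); near=> t; split.
  - by near: t; exact: nbhs_right_gt.
  - by rewrite -ltr_pdivlMr //; near: t; apply: nbhs_right_lt; rewrite divr_gt0.
  - by rewrite -ltr_pdivlMr //; near: t; apply: nbhs_right_lt; rewrite divr_gt0.
  - by near: t; exact: near_right_residual.
move=> [t0 tr te tM]; exists t; split=> //.
have := penalty_min (y := x + t *: u).
rewrite addrAC subrr add0r normrZ gtr0_norm // => /(_ _) h1.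
have {}h1 := h1 (le_lt_trans _ tr).
have := normD_le_inner ipP (t *: u) xv0.
rewrite (ipZr ipP) -/E normrZ gtr0_norm // addrAC => h2.
have h3 : t * `|u| <= t * (`|u| + 1) by rewrite ler_pM2l // lerDl.
have {h3} h1 := h1 h3.
have h4 : t * (t * (`|u| ^+ 2 / (`|x - v| *+ 2) + 1)) <= t * (e / 2).
  by rewrite ler_pM2l // ltW.
have : (t * `|u|) ^+ 2 / (`|x - v| *+ 2) = t * (t * (`|u| ^+ 2 / (`|x - v| *+ 2))).
  by rewrite exprMn; ring.
have := sqr_ge0 t.
move: h1 h2 h4 tM; rewrite (addrAC x).
lra.
Unshelve. all: by end_near. Qed.

(** Membership in the box yields the sign and complementarity conditions, and bounds each of the [n]
    multipliers by [M]. *)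
Lemma penalty_multipliers : exists lam : 'I_n -> R,
  [/\ `|x - v|^-1 *: (x - v) + \sum_(i < n) lam i *: g i = 0,
      forall i : 'I_n, (i < m)%N -> 0 <= lam i /\ lam i * h i p x = 0
    & \sum_(i < n) `|lam i| <= M *+ n].
Proof.
have [i|lam [lam0 lamP]] := box_multipliers ipP (lo := lo) (hi := hi) _ penalty_first_order.
  by rewrite /lo /hi; case: (i < m)%N => /=; [case: ifP => _|];
    rewrite ?lexx ?oppr_le0 ?(ltW M0).
exists lam; split=> // [i im|].
  have := lamP i; have := Fx i; rewrite /lo /hi im /= => hx.
  case: ltP => [_|hx' /andP[? _]]; first by rewrite -eq_le => /eqP <-; rewrite mul0r.
  by rewrite (_ : h i p x = 0) ?mulr0 //; apply/eqP; rewrite eq_le hx.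
rewrite -[n in leRHS]card_ord -sumr_const; apply: ler_sum => i _.
have /andP[l1 l2] := lamP i; rewrite ler_norml; apply/andP; split.
  by apply: le_trans l1; rewrite /lo; case: ifP; rewrite ?oppr_le0 ?(ltW M0).
by apply: (le_trans l2); rewrite /hi; case: ifP; rewrite ?(ltW M0).
Qed.

End PenaltyFirstOrder.

(** * The residual and the closedness of the feasible sets *)

Section ConstraintSystem.
Context {R : realType} {G H : normedModType R} {n : nat}.
Variables (m : nat) (h : 'I_n -> G -> H -> R).

Lemma residual_ge0 p x : 0 <= residual m h p x.
Proof. exact: bigmax_ge_id. Qed.

Lemma ge_residual (i : 'I_n) p x :
  (if (i < m)%N then h i p x else `|h i p x|) <= residual m h p x.
Proof. exact: (le_bigmax 0 _ i). Qed.

Lemma Fset_residualE p : Fset m h p = [set x | residual m h p x <= 0].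
Proof.
apply/seteqP; split=> x /= Fx.
  apply: bigmax_le => // i _; have := Fx i; case: ifP => // _ /eqP ->.
  by rewrite normr0.
move=> i; have := le_trans (ge_residual i p x) Fx; case: ifP => // _.
by rewrite normr_le0.
Qed.

Lemma residual_continuous p : (forall i, continuous (h i p)) ->
  continuous (residual m h p).
Proof.
move=> hc; apply: (continuous_big (@max_continuous _ R)) => i _.
case: (i < m)%N; first exact: hc.
by move=> x; exact: (cvg_norm (hc i x)).
Qed.

Lemma closed_Fset p : (forall i, continuous (h i p)) -> closed (Fset m h p).
Proof.
move=> hc; rewrite Fset_residualE.
apply: (@closed_comp _ _ (residual m h p) [set y | y <= 0]); last exact: closed_le.
by move=> x _; exact: residual_continuous.
Qed.

End ConstraintSystem.

Lemma dist_set_continuous (R : realType) (H : normedModType R) (S : set H) :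
  S !=set0 -> continuous (fun x => dist_set x S).
Proof.
move=> S0 x; apply/cvgrPdist_le => e e0; near=> y.
have xy : `|x - y| <= e by near: y; exact: cvgr_dist_le.
have := dist_set_lipschitz x y S0; have := dist_set_lipschitz y x S0.
by rewrite (distrC y) ler_norml => h1 h2; apply/andP; split; lra.
Unshelve. all: by end_near. Qed.

(** * Mean value theorem along a segment *)

Section MeanValue.
Context {R : realType} {H : normedModType R} {ip : H -> H -> R}.

Lemma mean_value_segment (f : H -> R) (df : H -> H) (x u : H) :
  (forall y, differentiable f y /\ forall w, 'd f y w = ip (df y) w) ->
  exists2 c : R, 0 < c < 1 & f (x + u) - f x = ip (df (x + c *: u)) u.
Proof.
move=> dfP; pose phi (s : R) := f (x + s *: u).
have phi_cvg (s : R) : t^-1 *: ((phi \o shift s) (t *: 1) - phi s) @[t --> 0^'] -->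
    ip (df (x + s *: u)) u.
  have [d1 /(_ u) d2] := dfP (x + s *: u).
  have := difference_quotient_cvg d1 d2; apply: cvg_trans; apply: near_eq_cvg.
  apply: nearW => t; rewrite /phi /= [t *: 1]mulr1.
  by rewrite (_ : x + (t + s) *: u = x + s *: u + t *: u) // scalerDl addrCA addrC.
have phi_der (s : R) : is_derive s 1 phi (ip (df (x + s *: u)) u).
  apply: DeriveDef; first by apply/cvg_ex; eexists; exact: phi_cvg.
  exact: cvg_lim (phi_cvg s).
have [|c c01] := MVT (@ltr01 R) (fun s _ => phi_der s).
  apply: continuous_subspaceT => s; apply: differentiable_continuous.
  by apply/derivable1_diffP; have [] := phi_der s.
rewrite /phi scale1r scale0r addr0 subr0 mulr1 => E.
by exists c => //; rewrite in_itv in c01.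
Qed.

End MeanValue.

(** * Error bound at projections with bounded multipliers *)

Section LocalErrorBound.
Context {R : realType} {G H : normedModType R} {ip : H -> H -> R}.
Hypothesis ipP : inner_product_of ip.
Context {n : nat} (m : nat) (h : 'I_n -> G -> H -> R) (gh : 'I_n -> G -> H -> H).
Variables (p0 : G) (x0 : H).
Hypothesis ghP : forall (i : 'I_n) (p : G) (x : H),
  differentiable (h i p) x /\ forall u : H, 'd (h i p) x u = ip (gh i p x) u.
Hypothesis ghc : forall i : 'I_n, continuous (fun q : G * H => gh i q.1 q.2).

(** Joint continuity at [(p0, x0)] suffices: both gradients lie within [e / 2] of [gh i p0 x0], on a
    neighbourhood common to the finitely many [i]. *)
Lemma gradients_equicontinuous (e : R) : 0 < e ->
  exists2 d : R, 0 < d & forall i p x y,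
    ball p0 d p -> ball x0 d x -> ball x0 d y -> `|gh i p x - gh i p y| <= e.
Proof.
move=> e0; have e2 : 0 < e / 2 by rewrite divr_gt0.
have : nbhs ((p0, x0) : (G * H)%type)
    [set q | forall i, `|gh i p0 x0 - gh i q.1 q.2| <= e / 2].
  refine (filter_forall (nbhs_filter ((p0, x0) : (G * H)%type)) _) => i.
  by have /cvgrPdist_le := @ghc i (p0, x0); exact.
move=> /nbhs_ballP[d /= d0 dP]; exists d => // i p x y dp dx dy.
have hx : `|gh i p0 x0 - gh i p x| <= e / 2 by apply: (dP (p, x)).
have hy : `|gh i p0 x0 - gh i p y| <= e / 2 by apply: (dP (p, y)).
rewrite -(subrKA (gh i p0 x0)); apply: (le_trans (ler_normD _ _)).
by rewrite (distrC (gh i p x)); lra.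
Qed.

Lemma LambdaM_error_bound (M : R) : 0 < M ->
  exists2 d : R, 0 < d & forall p x v, ball p0 d p -> ball x0 d x -> ball x0 d v ->
    Fset m h p x -> LambdaM m h gh M v p x !=set0 ->
    `|x - v| <= 2 * M * residual m h p v.
Proof.
(* With this accuracy the linearization errors, weighted by multipliers of total size at most [M],
   add up to at most [|x - v| / 2], which is absorbed on the left. *)
move=> M0; have e0 : 0 < (2 * M)^-1 by rewrite invr_gt0 mulr_gt0.
have [d d0 dP] := gradients_equicontinuous e0; exists d => // p x v dp dx dv Fx.
move=> [lam [[lam0 lamP] lamM]].
have r0 := residual_ge0 m h p v; set r := residual m h p v in r0 *.
have [->|xv] := eqVneq x v; first by rewrite subrr normr0 !mulr_ge0 // ltW.
have nxv : 0 < `|x - v| by rewrite normr_gt0 subr_eq0.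
set N := `|x - v| in nxv *.
(* Linearize [h i p] between [x] and [v]. Its value at [x] drops out, by complementarity for an
   inequality and by feasibility for an equality. *)
have lin i : lam i * ip (gh i p x) (v - x) <= `|lam i| * (r + (2 * M)^-1 * N).
  have [c /andP[c0 c1]] := mean_value_segment (f := h i p) x (v - x) (ghP i p).
  rewrite (addrC x (v - x)) subrK => mv.
  (* Balls are convex, so the intermediate point stays where the gradients are controlled. *)
  have dc : ball x0 d (x + c *: (v - x)).
    move: dx dv; rewrite -!ball_normE /= => dx dv.
    have -> : x0 - (x + c *: (v - x)) = (1 - c) *: (x0 - x) + c *: (x0 - v).
      rewrite -[v - x](subrKA x0) (addrC (v - x0)) -(opprB x0 v).
      by rewrite opprD addrA scalerBr opprB scalerBl scale1r addrA addrAC.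
    apply: le_lt_trans (ler_normD _ _) _.
    rewrite !normrZ !gtr0_norm ?subr_gt0 //.
    have : (1 - c) * `|x0 - x| < (1 - c) * d by rewrite ltr_pM2l ?subr_gt0.
    have : c * `|x0 - v| < c * d by rewrite ltr_pM2l.
    by lra.
  have := cauchy_schwarz_norm ipP (gh i p x - gh i p (x + c *: (v - x))) (v - x).
  have := dP i p _ _ dp dx dc; rewrite (ipBl ipP) -mv (distrC v) -/N => g1 g2.
  have {g1 g2} : `|ip (gh i p x) (v - x) - (h i p v - h i p x)| <= (2 * M)^-1 * N.
    by apply: (le_trans g2); rewrite ler_pM2r.
  have := ge_residual m h i p v; have := Fx i; have := lamP i; rewrite -/r.
  set q := (2 * M)^-1 * N; set I := ip _ _.
  case: (boolP (i < m)%N) => im.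
    move=> /(_ isT)[l0 l1] _ hr /ler_normlP[_ g1]; rewrite ger0_norm //.
    have : lam i * (I - (h i p v - h i p x)) <= lam i * q by rewrite ler_wpM2l.
    have : lam i * h i p v <= lam i * r by rewrite ler_wpM2l.
    by lra.
  move=> _ /eqP -> hr; rewrite subr0 => g1.
  apply: (le_trans (ler_norm _)); rewrite normrM ler_wpM2l //.
  have : `|I| <= `|I - h i p v| + `|h i p v| by rewrite -{1}(subrK (h i p v) I) ler_normD.
  by lra.
have : ip (N^-1 *: (x - v)) (v - x) + \sum_(i < n) lam i * ip (gh i p x) (v - x) = 0.
  under eq_bigr do rewrite -(ipZl ipP).
  by rewrite -(ip_suml ipP) -(ipDl ipP) lam0 (ip0l ipP).
rewrite -(opprB x v) (ipNr ipP) (ipZl ipP) (ipxx ipP) -/N opprB.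
rewrite expr2 mulrA mulVf ?gt_eqF // mul1r => E.
have : \sum_(i < n) lam i * ip (gh i p x) (v - x) <= M * (r + (2 * M)^-1 * N).
  apply: (@le_trans _ _ (\sum_(i < n) `|lam i| * (r + (2 * M)^-1 * N))).
    by apply: ler_sum.
  rewrite -mulr_suml ler_wpM2r // addr_ge0 // mulr_ge0 // ltW //.
have -> : M * (r + (2 * M)^-1 * N) = M * r + N / 2 by field; rewrite gt_eqF.
lra.
Qed.

End LocalErrorBound.

(** * The two implications *)

Section Equivalence.
Context {R : realType} {G : normedModType R} {n : nat} (m : nat).

(** Lower semicontinuity provides a point [y] of [F p] within [e / 4] of [x0]. Then
    [|x - v| <= |y - v| < e / 2], and the triangle inequality through [v] gives [3 e / 4]. *)
Lemma lsc_projections_near {H : normedModType R} (F : G -> set H) (P : set G)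
    (p0 : G) (x0 : H) (e : R) : lsc_rel F P p0 x0 -> 0 < e ->
  exists2 V : set G, nbhs p0 V & forall p v x, V p -> P p -> ball x0 (e / 4) v ->
    proj_set (F p) v x -> ball x0 (e * 3 / 4) x.
Proof.
move=> lsc e0; have e4 : 0 < e / 4 by rewrite divr_gt0.
have [V p0V VP] := lsc _ (nbhsx_ballx x0 _ e4); exists V => // p v x Vp Pp.
have [y Fy] := VP p Vp Pp; rewrite -!ball_normE /= => x0y x0v [_ xv].
have := dist_set_le v Fy; rewrite -xv.
have := ler_normD (x0 - v) (v - x); have := ler_normD (v - x0) (x0 - y).
rewrite !subrKA (distrC v x0) (distrC x v); lra.
Qed.

Context {H : completeNormedModType R} {ip : H -> H -> R}.
Hypothesis ipP : inner_product_of ip.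
Variables (h : 'I_n -> G -> H -> R) (gh : 'I_n -> G -> H -> H) (p0 : G) (x0 : H).
Hypothesis ghP : forall (i : 'I_n) (p : G) (x : H),
  differentiable (h i p) x /\ forall u : H, 'd (h i p) x u = ip (gh i p x) u.
Hypothesis lsc : lsc_rel (Fset m h) (domF m h) p0 x0.

Let uniform_multipliers (M : R) : Prop := forall (pk : nat -> G) (vk : nat -> H),
  pk @ \oo --> p0 -> (forall k, domF m h (pk k)) ->
  vk @ \oo --> x0 -> (forall k, ~ Fset m h (pk k) (vk k)) ->
  \forall k \near \oo, forall xk : H,
    proj_set (Fset m h (pk k)) (vk k) xk ->
    LambdaM m h gh M (vk k) (pk k) xk !=set0.

Lemma regular_uniform_multipliers : R_regular_rel m h (domF m h) p0 x0 ->
  exists2 M : R, 0 < M & uniform_multipliers M.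
Proof.
move=> [M M0 [Vp p0Vp [Vx /nbhs_ballP[d /= d0 dVx] reg]]].
have [V p0V VP] := lsc_projections_near lsc d0.
have d4 : 0 < d / 4 by rewrite divr_gt0.
(* The factor [n.+1] in place of [n] keeps the constant positive when [n = 0]. *)
exists (M *+ n.+1) => [|pk vk pkp0 Ppk vkx0 nFv]; first by rewrite pmulrn_lgt0.
near=> k => x Px; have [Fx xv] := Px.
have vkx : ball x0 (d / 4) (vk k).
  by near: k; move/cvg_ball: vkx0; exact.
have Vk : V (pk k) by near: k; exact: pkp0.
have Vpk : Vp (pk k) by near: k; exact: pkp0.
have := VP _ _ _ Vk (Ppk k) vkx Px; rewrite -ball_normE /= => x0x.
have neq : x != vk k by apply/eqP => E; apply: (nFv k); rewrite -E.
have [|lam [lam0 lamP lamM]] :=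
    penalty_multipliers ipP M0 d4 neq Fx (fun i => ghP i (pk k) x).
  (* As [x] is within [3 d / 4] of [x0] and [y] within [d / 4] of [x], regularity applies at [y]. *)
  move=> y yx; rewrite xv.
  have Vxy : Vx y.
    apply: dVx; rewrite -ball_normE /=.
    by have := ler_normD (x0 - x) (x - y); rewrite subrKA (distrC x y); lra.
  have := reg y (pk k) Vxy Vpk (Ppk k).
  have := dist_set_lipschitz (vk k) y (Ppk k); rewrite (distrC _ y); lra.
exists lam; split=> //; apply: (le_trans lamM).
by rewrite mulrS lerDr ltW.
Unshelve. all: by end_near. Qed.

Hypothesis ghc : forall i : 'I_n, continuous (fun q : G * H => gh i q.1 q.2).

Lemma uniform_multipliers_regular (M : R) : 0 < M -> uniform_multipliers M ->
  R_regular_rel m h (domF m h) p0 x0.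
Proof.
move=> M0 unif; have hc p i : continuous (h i p).
  by move=> x; apply: differentiable_continuous; have [] := ghP i p x.
apply: contrapT => nreg.
(* Regularity with constant [2 * M] fails on the balls of radius [1 / (k + 1)]. Its failure is a
   strict inequality between continuous functions, so the bad point can be moved to one that has a
   projection. *)
have /choice[q qP] k : exists q : G * H, [/\ domF m h q.1,
    ball p0 k.+1%:R^-1 q.1, ball x0 k.+1%:R^-1 q.2,
    2 * M * residual m h q.1 q.2 < dist_set q.2 (Fset m h q.1) &
    proj_set (Fset m h q.1) q.2 !=set0].
  have k0 : 0 < k.+1%:R^-1 :> R by rewrite invr_gt0.
  apply: contrapT => nq; apply: nreg; exists (2 * M); first by rewrite mulr_gt0.
  exists (ball p0 k.+1%:R^-1); first exact: nbhsx_ballx.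
  exists (ball x0 k.+1%:R^-1); first exact: nbhsx_ballx.
  move=> x p x0x p0p Pp; rewrite leNgt; apply/negP => xbad; apply: nq.
  pose g y := dist_set y (Fset m h p) - 2 * M * residual m h p y.
  have gc : continuous g.
    have rc : continuous (residual m h p) by exact: residual_continuous.
    by move=> y; exact: (cvgB (@dist_set_continuous _ _ _ Pp y) (cvgMl_tmp (rc y))).
  have [||y [[x0y gy] yP]] := dense_proj_set ipP Pp (closed_Fset (hc p))
      (O := ball x0 k.+1%:R^-1 `&` g @^-1` [set t | 0 < t]).
  - by exists x; split=> //=; rewrite subr_gt0.
  - apply: openI; first exact: ball_open.
    by apply: open_comp; [move=> y _; exact: gc|exact: open_gt].
  by exists (p, y); split=> //; move: gy; rewrite /g /= subr_gt0.
have inv_cvg : k.+1%:R^-1 @[k --> \oo] --> (0 : R) by exact: cvg_harmonic.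
have pk : (fst \o q) @ \oo --> p0.
  apply/cvg_ballP => e e0; near=> k; have [_ bk _ _ _] := qP k.
  apply: le_ball bk; apply/ltW; near: k.
  exact: near_infty_natSinv_lt (PosNum e0).
have vk : (snd \o q) @ \oo --> x0.
  apply/cvg_ballP => e e0; near=> k; have [_ _ bk _ _] := qP k.
  apply: le_ball bk; apply/ltW; near: k.
  exact: near_infty_natSinv_lt (PosNum e0).
(* At a feasible point the distance is [0], which cannot exceed the nonnegative residual term. *)
have nF k : ~ Fset m h (q k).1 (q k).2.
  move=> Fq; have [_ _ _ + _] := qP k; apply/negP; rewrite -leNgt.
  apply: (le_trans (dist_set_le _ Fq)); rewrite subrr normr0.
  by rewrite !mulr_ge0 ?residual_ge0 // ltW.
have domq k : domF m h (q k).1 by case: (qP k).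
have lam := unif _ _ pk domq vk nF.
have [d d0 dP] := LambdaM_error_bound ipP m p0 x0 ghP ghc M0.
have [V p0V VP] := lsc_projections_near lsc d0.
(* For one large [k] the projection has bounded multipliers and lies within [d] of [x0], so
   [LambdaM_error_bound] contradicts the choice of [q k]. *)
have [k [[lamk Vk] [p0k x0k]]] : exists k, ((forall xk : H,
    proj_set (Fset m h (q k).1) (q k).2 xk ->
    LambdaM m h gh M (q k).2 (q k).1 xk !=set0) /\ V (q k).1) /\
    (ball p0 d (q k).1 /\ ball x0 (d / 4) (q k).2).
  apply: (@filter_ex _ \oo); near=> k; split; split; near: k => //.
  - exact: pk.
  - by move/cvg_ball: pk; exact.
  - by move/cvg_ball: vk; apply; rewrite divr_gt0.
have [_ _ _ bad [x xP]] := qP k; have [Fx xv] := xP.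
have := VP _ _ _ Vk (domq k) x0k xP.
move/(le_ball (_ : d * 3 / 4 <= d)) => x0x.
have x0v : ball x0 d (q k).2 by apply: le_ball x0k; lra.
have {}x0x : ball x0 d x by apply: x0x; lra.
have := dP _ _ _ p0k x0x x0v Fx (lamk x xP).
by rewrite xv leNgt bad.
Unshelve. all: by end_near. Qed.

End Equivalence.

Theorem theorem8 (R : realType) (H : completeNormedModType R) (ip : H -> H -> R)
  (G : normedModType R) (n m : nat) (h : 'I_n -> G -> H -> R)
  (gh : 'I_n -> G -> H -> H) (p0 : G) (x0 : H) :
  inner_product_of ip ->
  (m <= n)%N ->
  (forall i : 'I_n, continuous (fun q : G * H => h i q.1 q.2)) ->
  (forall (i : 'I_n) (p : G) (x : H),
      differentiable (h i p) x /\ forall u : H, 'd (h i p) x u = ip (gh i p x) u) ->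
  (forall i : 'I_n, continuous (fun q : G * H => gh i q.1 q.2)) ->
  Fset m h p0 x0 ->
  lsc_rel (Fset m h) (domF m h) p0 x0 ->
  (R_regular_rel m h (domF m h) p0 x0 <->
   exists2 M : R, 0 < M &
     forall (pk : nat -> G) (vk : nat -> H),
       pk @ \oo --> p0 -> (forall k, domF m h (pk k)) ->
       vk @ \oo --> x0 -> (forall k, ~ Fset m h (pk k) (vk k)) ->
       \forall k \near \oo, forall xk : H,
         proj_set (Fset m h (pk k)) (vk k) xk ->
         LambdaM m h gh M (vk k) (pk k) xk !=set0).
Proof.
move=> ipP _ _ ghP ghc _ lsc; split.
  exact: (regular_uniform_multipliers ipP).
by move=> [M M0 unif]; exact: (uniform_multipliers_regular ipP ghP lsc ghc M0 unif).
Qed.
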